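(* Let $X$ be a Baire space and $Y$ a metric space with metric $\rho$. The collection $\Upsilon$ of filters on $\mathcal{M}(X,Y)\times\mathcal{M}(X,Y)$ (defined in the context) is a uniform convergence structure on $\mathcal{M}(X,Y)$, i.e. (1) $\langle f\rangle\times\langle f\rangle\in\Upsilon$ for all $f\in\mathcal{M}(X,Y)$; (2) $\mathcal{U}\cap\mathcal{V}\in\Upsilon$ whenever $\mathcal{U},\mathcal{V}\in\Upsilon$; (3) if $\mathcal{U}\in\Upsilon$, then $\mathcal{V}\in\Upsilon$ for each filter $\mathcal{V}$ on $\mathcal{M}(X,Y)\times\mathcal{M}(X,Y)$ with $\mathcal{V}\supseteq\mathcal{U}$; (4) if $\mathcal{U}\in\Upsilon$, then $\mathcal{U}^{-1}\in\Upsilon$; (5) for all $\mathcal{U},\mathcal{V}\in\Upsilon$ one has $\mathcal{U}\circ\mathcal{V}\in\Upsilon$ whenever the composition $\mathcal{U}\circ\mathcal{V}$ exists. Moreover $\Upsilon$ induces the convergence structure on $\mathcal{M}(X,Y)$: for every $f\in\mathcal{M}(X,Y)$ and every filter $\mathcal{F}$ on $\mathcal{M}(X,Y)$, $\langle f\rangle\times\mathcal{F}\in\Upsilon$ if and only if $\mathcal{F}\to f$.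
   Context: For a Hausdorff space $Z$, a set-valued map $g:X\to Z$ is usco if $g(x)$ is a nonempty compact subset of $Z$ for each $x\in X$ and $\{x\in X: g(x)\subset U\}$ is open in $X$ for each open $U\subset Z$. Set-valued maps are identified with their graphs ($h\subset g$ means $h(x)\subset g(x)$ for all $x$). A usco map $g$ is minimal if $h=g$ for every usco $h\subset g$. $\mathcal{M}(X,Z)$ is the set of minimal usco maps from $X$ to $Z$, and for a usco map $g:X\to Z$, $[g]=\{f\in\mathcal{M}(X,Z):f\subset g\}$. A usco map $g$ is quasiminimal if $[g]$ has exactly one element. No separation axioms are assumed on $X$. A filter $\mathcal{F}$ on $\mathcal{M}(X,Z)$ is bounded if $[g]\in\mathcal{F}$ for some usco $g:X\to Z$. It converges to $f\in\mathcal{M}(X,Z)$ ($\mathcal{F}\to f$) if it is bounded and $\{f\}=\bigcap\{[g]:g \text{ usco},[g]\in\mathcal{F}\}$; this is the convergence structure on $\mathcal{M}(X,Z)$. For $f,g\in\mathcal{M}(X,Y)$, the map $f\times g:X\to Y\times Y$, $(f\times g)(x)=f(x)\times g(x)$, is a quasiminimal usco map (since $X$ is Baire and $Y$ metric), and $\chi:\mathcal{M}(X,Y)\times\mathcal{M}(X,Y)\to\mathcal{M}(X,Y\times Y)$ is defined by $\{\chi(f,g)\}=[f\times g]$. For a filter $\mathcal{U}$ on $\mathcal{M}(X,Y)\times\mathcal{M}(X,Y)$, $\chi(\mathcal{U})$ is the filter generated by $\{\chi(U):U\in\mathcal{U}\}$. For a usco map $\phi:X\to Y\times Y$, $\rho\circ\phi:X\to\mathbb{R}$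 is the usco map $(\rho\circ\phi)(x)=\{\rho(y_1,y_2):(y_1,y_2)\in\phi(x)\}$. $\Upsilon$ is the family of all filters $\mathcal{U}$ on $\mathcal{M}(X,Y)\times\mathcal{M}(X,Y)$ such that the filter $\chi(\mathcal{U})$ is bounded in $\mathcal{M}(X,Y\times Y)$, and the filter generated by $\{[\rho\circ\phi]:\phi \text{ usco},\ [\phi]\in\chi(\mathcal{U})\}$ converges in $\mathcal{M}(X,\mathbb{R})$ to the constant function $0$ (regarded as the map $x\mapsto\{0\}$). Notation: $\langle f\rangle$ is the filter generated by $\{\{f\}\}$; $\mathcal{F}_1\times\mathcal{F}_2$ is the filter generated by $\{F_1\times F_2:F_1\in\mathcal{F}_1,F_2\in\mathcal{F}_2\}$; $U^{-1}=\{(f,g):(g,f)\in U\}$ and $\mathcal{U}^{-1}=\{U^{-1}:U\in\mathcal{U}\}$; $U\circ V=\{(f,g):\exists h\in\mathcal{M}(X,Y):(f,h)\in V,(h,g)\in U\}$. If $U\circ V\ne\emptyset$ for all $U\in\mathcal{U}$, $V\in\mathcal{V}$, then $\mathcal{U}\circ\mathcal{V}$ is the filter generated by $\{U\circ V:U\in\mathcal{U},V\in\mathcal{V}\}$, and the composition is said to exist. *)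

(* Defs.v *)
From HB Require Import structures.
From mathcomp Require Import all_boot all_order all_algebra.
From mathcomp Require Import all_classical all_reals all_analysis.
Import numFieldNormedType.Exports.

Set Implicit Arguments.
Unset Strict Implicit.
Unset Printing Implicit Defensive.

Local Open Scope classical_set_scope.
Local Open Scope ring_scope.

(** Filters are proper, as is usual for convergence
    structures: [Filter] alone would admit the improper filter [setT], so
    [ProperFilter] is required wherever a filter is quantified over. *)

Definition baire_space (X : topologicalType) : Prop :=
  forall D : nat -> set X,
    (forall n, open (D n) /\ dense (D n)) -> dense (\bigcap_n D n).

Definition filter_generated (T : Type) (G : set_system T) : set_system T :=
  smallest (@Filter T) G.

Section usco_maps.
Context (X Z : topologicalType).

Definition subgraph (h g : X -> set Z) : Prop := forall x, h x `<=` g x.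

(** Meant for Hausdorff [Z]; below [Z] is a metric space [Y], its square, or
    the real line. *)
Definition usco (g : X -> set Z) : Prop :=
  (forall x, g x !=set0 /\ compact (g x)) /\
  (forall U : set Z, open U -> open [set x | g x `<=` U]).

Definition minimal_usco (g : X -> set Z) : Prop :=
  usco g /\ forall h, usco h -> subgraph h g -> h = g.

Definition musco : Type := {f : X -> set Z | minimal_usco f}.

Definition musco_fun (f : musco) : X -> set Z := proj1_sig f.

(** [[g]]; the definition makes sense for any set-valued [g]. *)
Definition musco_below (g : X -> set Z) : set musco :=
  [set f | subgraph (musco_fun f) g].

Definition mbounded (F : set_system musco) : Prop :=
  exists2 g, usco g & F (musco_below g).

Definition mconverges (F : set_system musco) (f : musco) : Prop :=
  mbounded F /\
  [set f] = \bigcap_(g in [set g | usco g /\ F (musco_below g)]) musco_below g.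

End usco_maps.

Arguments musco : clear implicits.
Arguments musco_fun {X Z} f x.

(** [mconverges] to the map [x |-> {z}]: a minimal usco map whose underlying
    set-valued map is that constant. *)
Definition mconverges_cst (X Z : topologicalType) (F : set_system (musco X Z))
    (z : Z) : Prop :=
  exists2 f : musco X Z, musco_fun f = (fun=> [set z]) & mconverges F f.

Section chi_upsilon.
Context (R : realType) (X : topologicalType) (Y : metricType R).

Local Notation M := (musco X Y).
Local Notation MM := (musco X (Y * Y)%type).

Definition usco_prod (f g : X -> set Y) : X -> set (Y * Y) :=
  fun x => f x `*` g x.

(** The graph of the map chi, given by the equation [{chi (f, g)} = [f x g]];
    it is everywhere defined when [X] is Baire. *)
Definition is_chi (p : M * M) (h : MM) : Prop :=
  [set h] = musco_below (usco_prod (musco_fun p.1) (musco_fun p.2)).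

Definition chi_image (A : set (M * M)) : set MM :=
  [set h | exists2 p, A p & is_chi p h].

Definition chi_filter (U : set_system (M * M)) : set_system MM :=
  filter_generated (chi_image @` U).

Definition rho_comp (phi : X -> set (Y * Y)) : X -> set R :=
  fun x => [set mdist p.1 p.2 | p in phi x].

Definition rho_filter (U : set_system (M * M)) : set_system (musco X R) :=
  filter_generated
    [set musco_below (rho_comp phi) |
      phi in [set phi | usco phi /\ chi_filter U (musco_below phi)]].

Definition Upsilon : set (set_system (M * M)) :=
  [set U | [/\ ProperFilter U,
               mbounded (chi_filter U) &
               mconverges_cst (rho_filter U) (0 : R)]].

End chi_upsilon.

Arguments Upsilon {R} X Y.

Section uniform_convergence.
Context (M : Type).
Local Open Scope relation_scope.

Definition inverse_filter (U : set_system (M * M)) : set_system (M * M) :=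
  [set A^-1 | A in U].

(** The library's [B \; A] relates [f] to [g] when [(f, h)] is in [B] and
    [(h, g)] is in [A] for some [h], so it denotes the composition [A o B]. *)
Definition comp_exists (U V : set_system (M * M)) : Prop :=
  forall A B, U A -> V B -> (B \; A) !=set0.

Definition comp_filter (U V : set_system (M * M)) : set_system (M * M) :=
  filter_generated [set C | exists A B, [/\ U A, V B & C = B \; A]].

Record uniform_convergence_structure (J : set (set_system (M * M))) : Prop := {
  ucs_filter : forall U, J U -> ProperFilter U;
  ucs_diag : forall f : M,
    J (filter_prod (principal_filter f) (principal_filter f));
  ucs_inter : forall U V, J U -> J V -> J (U `&` V);
  ucs_up : forall U V, J U -> ProperFilter V -> U `<=` V -> J V;
  ucs_inv : forall U, J U -> J (inverse_filter U);
  ucs_comp : forall U V, J U -> J V -> comp_exists U V -> J (comp_filter U V)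
}.

Definition induces_convergence (J : set (set_system (M * M)))
    (conv : set_system M -> M -> Prop) : Prop :=
  forall (f : M) (F : set_system M), ProperFilter F ->
    (J (filter_prod (principal_filter f) F) <-> conv F f).

End uniform_convergence.

(* Main.v *)
(** The usco conditions defining [Upsilon] are traded for a local condition on
    pairs.  Cutting a usco map down to a closed set [C] over an open set [V]
    gives a usco map as soon as all its values over [V] meet [C]; so a minimal
    usco map whose values over [V] meet [C] has its values over [V] inside [C].
    Together with compactness (the usco maps [g] with [[g]] in a given bounded
    filter are directed, hence their intersection is usco), this shows that
    [F --> f] iff [F] is bounded and, whenever [f] meets an open [O] over an open
    [W], some [[g]] in [F] has a value over [W] inside [O].  Applied to the filter
    of the maps [rho o phi] and to the constant [0], it turns [U \in Upsilon] into:
    [U] is bounded and, for every [e > 0], every nonempty open set contains a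
    nonempty open [V] over which the pairs of some member of [U] are all e-close.
    The axioms are then immediate, except that composition uses that the
    intermediate map is single-valued on a dense set, which is where [X] being
    Baire matters, besides making [chi] total. *)
Require Import Defs.
From mathcomp Require Import all_boot all_order all_algebra.
From mathcomp Require Import all_classical all_reals all_analysis.
From mathcomp Require Import lra.
Import Order.TTheory GRing.Theory Num.Theory.
Import numFieldNormedType.Exports.

Set Implicit Arguments.
Unset Strict Implicit.
Unset Printing Implicit Defensive.

Local Open Scope classical_set_scope.
Local Open Scope ring_scope.

(** * Products, compactness and the diagonal *)

Section topology.
Context {Y Z : topologicalType}.

Lemma hausdorff_setX : hausdorff_space Y -> hausdorff_space Z ->
  hausdorff_space (Y * Z)%type.
Proof.
move=> hY hZ [p1 p2] [q1 q2] pq; congr pair.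
  apply: hY => A B Ap Bq.
  have [] := pq (A `*` setT) (B `*` setT).
  - by exists (A, setT) => //; split => //; exact: filterT.
  - by exists (B, setT) => //; split => //; exact: filterT.
  by move=> [y z] [[/= Ay _] [/= By _]]; exists y.
apply: hZ => A B Ap Bq.
have [] := pq (setT `*` A) (setT `*` B).
- by exists (setT, A) => //; split => //; exact: filterT.
- by exists (setT, B) => //; split => //; exact: filterT.
by move=> [y z] [[/= _ Az] [/= _ Bz]]; exists z.
Qed.

Lemma closed_diagonal : hausdorff_space Z -> closed [set p : Z * Z | p.1 = p.2].
Proof.
move=> hZ [p q] pq; apply: hZ => A B Ap Bq.
have [] := pq (A `*` B); first by exists (A, B).
by move=> [a b] [/= ab [/= Aa Bb]]; exists a; split => //; rewrite ab.
Qed.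

(* The tube lemma, applied twice: first around a point, then around [K]. *)
Lemma compact_setX_sub_open (K : set Y) (L : set Z) (O : set (Y * Z)) :
  compact K -> compact L -> open O -> K `*` L `<=` O ->
  exists U V, [/\ open U, open V, K `<=` U, L `<=` V & U `*` V `<=` O].
Proof.
move=> cK cL oO KLO.
have tube y : K y -> exists2 U, nbhs y U & exists V,
    [/\ open V, L `<=` V & U `*` V `<=` O].
  move=> Ky; pose Q (U : set Y) (z : Z) := \forall z' \near z, U `*` [set z'] `<=` O.
  have /compact_near_coveringP/(_ _ (powerset_filter_from (nbhs y)) Q) := cL.
  case=> [z Lz|].
    have [[A B] /= [Ay Bz] AB] : nbhs (y, z) O.
      by apply: open_nbhs_nbhs; split => //; apply: KLO.
    have [B' [oB' B'z] B'B] : exists2 B', open_nbhs z B' & B' `<=` B.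
      by move: Bz; rewrite nbhsE.
    exists (B', [set U | U `<=` A]).
      split; first exact: open_nbhs_nbhs.
      exact: small_set_sub.
    move=> [z' U] /= [B'z' UA].
    apply: (@filterS _ _ _ B'); last exact: open_nbhs_nbhs.
    move=> z'' B'z'' [u v] /= [Uu ->]; apply: AB.
    by split => /=; [exact: UA|exact: B'B].
  move=> M [Msub Mdown [U MU]] /(_ _ MU) LQ.
  exists U; first exact: Msub.
  exists [set z | Q U z]°; split; first exact: open_interior.
    by move=> z Lz; apply: nbhs_interior; exact: LQ.
  move=> [u v] /= [Uu /interior_subset]; rewrite /= /Q => /nbhs_singleton.
  exact.
pose Q (V : set Z) (y : Y) := \forall y' \near y, [set y'] `*` V `<=` O.
have [V0 [oV0 LV0]] : exists V : set Z, open V /\ L `<=` V.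
  by exists setT; split => //; exact: openT.
pose F := filter_from [set V : set Z | open V /\ L `<=` V]
  (fun V => [set V' | V' `<=` V]).
have FF : Filter F.
  apply: filter_from_filter; first by exists V0.
  move=> V1 V2 [oV1 LV1] [oV2 LV2]; exists (V1 `&` V2).
    split; first exact: openI.
    by move=> z Lz; split; [exact: LV1|exact: LV2].
  by move=> V' V'V; split => z /V'V[].
have /compact_near_coveringP/(_ _ F Q FF) := cK.
case=> [y Ky|].
  have [U Uy [V [oV LV UVO]]] := tube y Ky.
  exists (U°, [set V' | V' `<=` V]).
    by split; [exact: nbhs_interior|exists V].
  move=> [y' V'] /= [Uy' V'V].
  apply: filterS Uy' => y'' Uy'' [u v] /= [-> V'v]; apply: UVO.
  by split => //=; exact: V'V.
move=> V [oV LV] /(_ V (@subset_refl _ _)) KQ.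
exists [set y | Q V y]°, V; split => //; first exact: open_interior.
  by move=> y Ky; apply: nbhs_interior; exact: KQ.
move=> [u v] /= [/interior_subset + Vv]; rewrite /= /Q => /nbhs_singleton.
exact.
Qed.

Lemma open_local (A : set Y) :
  (forall x, A x -> exists B, [/\ open B, B x & B `<=` A]) -> open A.
Proof.
move=> h; rewrite openE => x /h[B [oB Bx BA]].
by apply: filterS BA _; exact: open_nbhs_nbhs.
Qed.

End topology.

(** * Operations on usco maps *)

Section usco_operations.
Context {X : topologicalType}.

(** The implication leaves [g] untouched off [V], so a cut made over an open set still yields a map
    on all of [X]. *)
Definition restr {Z : topologicalType} (g : X -> set Z) (V : set X)
    (C : set Z) : X -> set Z :=
  fun x => [set z | g x z /\ (V x -> C z)].

Lemma usco_restr (Z : topologicalType) (g : X -> set Z) (V : set X) (C : set Z) :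
  usco g -> open V -> closed C -> (forall x, V x -> g x `&` C !=set0) ->
  usco (restr g V C).
Proof.
move=> [g1 g2] oV cC gC; split=> [x|O oO].
  have [Vx|nVx] := pselect (V x).
    suff -> : restr g V C x = g x `&` C.
      by split; [exact: gC|apply: compact_closedI => //; have [] := g1 x].
    by apply/seteqP; split => [z [gz /(_ Vx)]|z [gz Cz]].
  suff -> : restr g V C x = g x by exact: g1.
  by apply/seteqP; split => [z []|z gz].
(* Over [V] the cut value lies in [O] exactly when [g x] lies in [O] together with the complement of
   [C], which is open because [C] is closed. *)
rewrite (_ : mkset _ =
    [set x | g x `<=` O] `|` (V `&` [set x | g x `<=` O `|` ~` C])).
  apply: openU; first exact: g2.
  by apply: openI => //; apply: g2; apply: openU => //; exact: closed_openC.
apply/seteqP; split=> x.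
  move=> rO; have [Vx|nVx] := pselect (V x).
    right; split => // z gz; have [Cz|nCz] := pselect (C z); last by right.
    by left; apply: rO.
  by left => z gz; apply: rO.
move=> [gO z [gz _]|[Vx gOC] z [gz Cz]]; first exact: gO.
by case: (gOC z gz) => // nCz; have := Cz Vx.
Qed.

Lemma minimal_usco_sub_closed (Z : topologicalType) (g : X -> set Z)
    (V : set X) (C : set Z) :
  minimal_usco g -> open V -> closed C -> (forall x, V x -> g x `&` C !=set0) ->
  forall x, V x -> g x `<=` C.
Proof.
move=> [ug mg] oV cC gC x Vx z gz.
have gE : restr g V C = g.
  by apply: mg; [exact: usco_restr|move=> y w []].
by move: gz; rewrite -gE => -[_]; apply.
Qed.

(** If no value over [V] were inside [O], all of them would meet the closed complement of [O];
    minimality would then push them all into it, although [g x] meets [O]. *)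
Lemma minimal_usco_local (Z : topologicalType) (g : X -> set Z)
    (V : set X) (O : set Z) x :
  minimal_usco g -> open V -> open O -> V x -> g x `&` O !=set0 ->
  exists W, [/\ open W, W !=set0, W `<=` V & forall w, W w -> g w `<=` O].
Proof.
move=> mg oV oO Vx [z [gz Oz]].
have [[y [Vy gyO]]|nW] := pselect (exists y, V y /\ g y `<=` O).
  exists (V `&` [set y | g y `<=` O]); split.
  - by apply: openI => //; case: mg => -[_ g2] _; exact: g2.
  - by exists y.
  - by move=> w [].
  - by move=> w [].
have : g x `<=` ~` O.
  apply: (@minimal_usco_sub_closed _ _ V) => //; first exact: open_closedC.
  move=> y Vy; apply: contrapT => gyO; apply: nW; exists y; split => // w gw.
  by apply: contrapT => nOw; apply: gyO; exists w.
by move=> /(_ z gz).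
Qed.

Lemma usco_image (Z Z' : topologicalType) (phi : Z -> Z') (g : X -> set Z) :
  continuous phi -> usco g -> usco (fun x => phi @` g x).
Proof.
move=> cphi [g1 g2]; split=> [x|O oO].
  have [[z gz] cg] := g1 x; split; first by exists (phi z); exists z.
  by apply: continuous_compact => //; apply: continuous_subspaceT.
rewrite (_ : mkset _ = [set x | g x `<=` phi @^-1` O]).
  by apply: g2; apply: open_comp => // z _; exact: cphi.
by apply/seteqP; split => x; rewrite /= image_sub.
Qed.

Lemma usco_setX (Y Z : topologicalType) (f : X -> set Y) (g : X -> set Z) :
  usco f -> usco g -> usco (fun x => f x `*` g x).
Proof.
move=> [f1 f2] [g1 g2]; split=> [x|O oO].
  have [[y fy] cf] := f1 x; have [[z gz] cg] := g1 x.
  by split; [exists (y, z)|exact: compact_setX].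
(* The tube lemma puts a product of two open sets between [f x * g x] and [O], so each factor can be
   controlled separately. *)
apply: open_local => x /= fgO.
have [U [V [oU oV fU gV UVO]]] :=
  compact_setX_sub_open (f1 x).2 (g1 x).2 oO fgO.
exists ([set y | f y `<=` U] `&` [set y | g y `<=` V]); split => //.
  by apply: openI; [exact: f2|exact: g2].
by move=> y [fyU gyV] [a b] [/= fa gb]; apply: UVO; split; [exact: fyU|exact: gyV].
Qed.

Lemma uscoU (Z : topologicalType) (f g : X -> set Z) :
  usco f -> usco g -> usco (fun x => f x `|` g x).
Proof.
move=> [f1 f2] [g1 g2]; split=> [x|O oO].
  have [[z fz] cf] := f1 x; have [_ cg] := g1 x.
  by split; [exists z; left|exact: compactU].
rewrite (_ : mkset _ = [set x | f x `<=` O] `&` [set x | g x `<=` O]).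
  by apply: openI; [exact: f2|exact: g2].
by apply/seteqP; split => x; rewrite /= subUset.
Qed.

Lemma usco_cst1 (Z : topologicalType) (z : Z) : usco (fun _ : X => [set z]).
Proof.
split=> [x|O oO]; first by split; [exists z|exact: compact_set1].
have [Oz|nOz] := pselect (O z).
  rewrite (_ : mkset _ = setT); first exact: openT.
  by apply/seteqP; split => // x _ y ->.
rewrite (_ : mkset _ = set0); first exact: open0.
by apply/seteqP; split => // x /(_ z erefl).
Qed.

Section hausdorff.
Context {Z : topologicalType} (hZ : hausdorff_space Z).

Lemma uscoI (f g : X -> set Z) : usco f -> usco g ->
  (forall x, f x `&` g x !=set0) -> usco (fun x => f x `&` g x).
Proof.
move=> uf ug fg.
(* The part of [f x g] over the diagonal, projected. *)
have uD : usco (restr (fun x => f x `*` g x) setT [set p | p.1 = p.2]).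
  apply: usco_restr; [exact: usco_setX|exact: openT|exact: closed_diagonal|].
  by move=> x _; have [z [fz gz]] := fg x; exists (z, z).
rewrite (_ : (fun x => _) =
    fun x => fst @` restr (fun x => f x `*` g x) setT [set p | p.1 = p.2] x).
  by apply: usco_image => // p; exact: cvg_fst.
apply/funext => x; apply/seteqP; split=> [z [fz gz]|_ [[a b] /= [[/= fa gb]] ab] <-].
  by exists (z, z).
by split => //=; rewrite ab.
Qed.

(** The points where the product of the two values misses the closed diagonal form an open set; were
    it nonempty, it would meet [D]. *)
Lemma usco_meet_dense (f g : X -> set Z) (D : set X) : usco f -> usco g ->
  dense D -> (forall x, D x -> f x `&` g x !=set0) ->
  forall x, f x `&` g x !=set0.
Proof.
move=> uf ug dD fg x; apply: contrapT => nfg.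
have [_ /(_ (~` [set p | p.1 = p.2]))] := usco_setX uf ug.
move=> /(_ (closed_openC (closed_diagonal hZ))) /dD.
case=> [|y [fgy /fg[z [fz gz]]]]; last by apply: (fgy (z, z)).
by exists x => -[a b] [/= fa gb] ab; apply: nfg; exists a; split => //; rewrite ab.
Qed.

(** The intersection of [f] and [g] is a usco map below [f], hence equal to [f]. *)
Lemma minimal_usco_sub (f g : X -> set Z) : minimal_usco f -> usco g ->
  (forall x, f x `&` g x !=set0) -> subgraph f g.
Proof.
move=> [uf mf] ug fg x z.
by rewrite -{1}(mf _ (uscoI uf ug fg)) => [[]|y w []].
Qed.

Lemma minimal_usco_eq (f g : X -> set Z) : minimal_usco f -> minimal_usco g ->
  (forall x, f x `&` g x !=set0) -> f = g.
Proof.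
move=> mf [ug mg] fg; apply: mg; first by case: mf.
exact: minimal_usco_sub.
Qed.

Definition directed_usco (G : set (X -> set Z)) : Prop :=
  [/\ G !=set0, G `<=` @usco X Z &
    forall g h, G g -> G h -> exists k, [/\ G k, subgraph k g & subgraph k h]].

(** The sets [g x] cut by [C] form a filter base inside the compact set [g0 x]. A cluster point lies
    in [C] and in every [g x], all of these being closed. *)
Lemma directed_usco_meet (G : set (X -> set Z)) (C : set Z) x :
  directed_usco G -> closed C -> (forall g, G g -> g x `&` C !=set0) ->
  (\bigcap_(g in G) g x) `&` C !=set0.
Proof.
move=> [[g0 Gg0] Gusco Gdir] cC GC.
pose F := filter_from G (fun g => g x `&` C).
have FF : ProperFilter F.
  apply: filter_from_proper; last exact: GC.
  apply: filter_from_filter; first by exists g0.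
  move=> g h Gg Gh; have [k [Gk kg kh]] := Gdir g h Gg Gh; exists k => //.
  by move=> z [kz Cz]; split; split => //; [exact: kg|exact: kh].
have Fg g : G g -> F (g x) by move=> Gg; exists g => // z [].
have cg g : G g -> closed (g x).
  by move=> Gg; apply: compact_closed => //; have [/(_ x)[]] := Gusco g Gg.
have [/(_ x)[_ /(_ F FF (Fg g0 Gg0))[z [_ zF]]] _] := Gusco g0 Gg0.
exists z; split.
  move=> g Gg; apply: (cg g Gg) => B Bz; exact: zF (Fg g Gg) Bz.
apply: cC => B Bz; apply: zF Bz; exists g0 => // w [].
Qed.

(** By compactness, if the intersection at [x] lies in an open [O], then some single [g x] already
    does, and upper semicontinuity of that [g] suffices. *)
Lemma usco_bigcap (G : set (X -> set Z)) : directed_usco G ->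
  usco (fun x => \bigcap_(g in G) g x).
Proof.
move=> dG; have [[g0 Gg0] Gusco Gdir] := dG.
have cg g x : G g -> closed (g x).
  by move=> Gg; apply: compact_closed => //; have [/(_ x)[]] := Gusco g Gg.
split=> [x|O oO].
  split.
    have [g Gg|z [Gz _]] := @directed_usco_meet G setT x dG closedT; last by exists z.
    by rewrite setIT; have [/(_ x)[]] := Gusco g Gg.
  have -> : \bigcap_(g in G) g x = g0 x `&` \bigcap_(g in G) g x.
    by rewrite setIidr // => z; apply.
  apply: compact_closedI; first by have [/(_ x)[]] := Gusco g0 Gg0.
  by apply: closed_bigI => g Gg; exact: cg.
apply: open_local => x /= GO.
have [g [Gg gO]] : exists g, G g /\ g x `<=` O.
  apply: contrapT => nG.
  have [g Gg|z [Gz]] := @directed_usco_meet G (~` O) x dG (open_closedC oO).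
    apply: contrapT => gO; apply: nG; exists g; split => // z gz.
    by apply: contrapT => nOz; apply: gO; exists z.
  by apply; exact: GO.
exists [set y | g y `<=` O]; split => //.
  by have [_] := Gusco g Gg; exact.
by move=> y gyO z Gz; apply: gyO; exact: Gz.
Qed.

(** Zorn's lemma on the usco maps below [g], ordered by reverse inclusion: a nonempty chain is
    bounded by its intersection. *)
Lemma minimal_usco_exists (g : X -> set Z) : usco g ->
  exists2 f, minimal_usco f & subgraph f g.
Proof.
move=> ug; pose T := {h : X -> set Z | usco h /\ subgraph h g}.
have T_inj (s t : T) : sval s = sval t -> s = t.
  by move: s t => [s sp] [t tp] /= st; move: tp; rewrite -st => tp; congr exist.
pose r (s t : T) : bool := `[< subgraph (sval t) (sval s) >].
have [||||[f [uf fg]] fmin] := @Zorn T r.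
- by move=> t; apply/asboolP => x.
- by move=> a b c /asboolP ab /asboolP bc; apply/asboolP => x z /bc /ab.
- move=> s t /asboolP st /asboolP ts; apply: T_inj; apply/funext => x.
  by apply/seteqP; split; [exact: ts|exact: st].
- move=> A Atot.
  have [A0|A0] := pselect (A !=set0); last first.
    (* The empty chain is bounded by [g] itself. *)
    exists (exist _ g (conj ug (fun x => @subset_refl _ _))) => s As.
    by case: A0; exists s.
  have dA : directed_usco (sval @` A).
    split; first by have [a Aa] := A0; exists (sval a); exists a.
      by move=> _ [a Aa <-]; have [] := svalP a.
    move=> _ _ [a Aa <-] [b Ab <-]; case: (Atot a b Aa Ab) => /asboolP ab.
      by exists (sval b); split => // x z.
    by exists (sval a); split => // x z.
  have ub := usco_bigcap dA.
  have bg : subgraph (fun x => \bigcap_(h in sval @` A) h x) g.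
    have [a Aa] := A0; move=> x z zA; have [_ /(_ x z)] := svalP a; apply.
    by apply: zA; exists a.
  exists (exist (fun h => usco h /\ subgraph h g) _ (conj ub bg)) => s As.
  by apply/asboolP => x z /=; apply; exists s.
exists f => //; split => // h uh hf.
have hg : subgraph h g by move=> x z /hf /fg.
have := fmin (exist _ h (conj uh hg)); rewrite /r /= => fh.
by have /(_ _)/(congr1 sval) := fh; apply; apply/asboolP.
Qed.

End hausdorff.
End usco_operations.

(** * Filters generated by a base *)

Section filter_generated.
Context {T : Type} (G : set_system T).
Context (G0 : G !=set0)
  (GI : forall A B, G A -> G B -> exists2 C, G C & C `<=` A `&` B).

Lemma filter_generatedE : filter_generated G = filter_from G id.
Proof.
apply/seteqP; split=> [A|A [B GB BA] F [FF GF]]; last first.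
  by apply: filterS BA _; exact: GF.
apply; split; first exact: filter_from_filter.
by move=> B GB; exists B.
Qed.

Lemma filter_generated_proper : (forall A, G A -> A !=set0) ->
  ProperFilter (filter_generated G).
Proof.
move=> Gne; rewrite filter_generatedE.
by apply: filter_from_proper => //; exact: filter_from_filter.
Qed.

End filter_generated.

(** * Convergence of filters of minimal usco maps *)

Section mconvergence.
Context {X Z : topologicalType} (hZ : hausdorff_space Z).

Lemma musco_fun_inj : injective (@musco_fun X Z).
Proof.
by move=> [f fm] [g gm] /= fg; move: gm; rewrite -fg => gm; congr exist.
Qed.

Lemma musco_minimal (f : musco X Z) : minimal_usco (musco_fun f).
Proof. exact: proj2_sig. Qed.

Lemma musco_usco (f : musco X Z) : usco (musco_fun f).
Proof. by case: (musco_minimal f). Qed.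

Lemma musco_nonempty (f : musco X Z) x : musco_fun f x !=set0.
Proof. by have [/(_ x)[]] := musco_usco f. Qed.

Lemma musco_below_nonempty (g : X -> set Z) : usco g -> musco_below g !=set0.
Proof.
by move=> /(minimal_usco_exists hZ)[f mf fg]; exists (exist _ f mf).
Qed.

Lemma musco_below_sub (g h : X -> set Z) : subgraph g h ->
  musco_below g `<=` musco_below h.
Proof. by move=> gh f fg x z /fg /gh. Qed.

Section filter.
Context (F : set_system (musco X Z)) {FF : ProperFilter F}.

(** The two members of [F] share some [f], whose nonempty values lie in both maps. *)
Lemma mfilter_meet (g h : X -> set Z) : F (musco_below g) -> F (musco_below h) ->
  forall x, g x `&` h x !=set0.
Proof.
move=> Fg Fh x; have [f [fg fh]] := filter_ex (filterI Fg Fh).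
by have [z fz] := musco_nonempty f x; exists z; split; [exact: fg|exact: fh].
Qed.

Lemma mfilter_directed : mbounded F ->
  directed_usco [set g | usco g /\ F (musco_below g)].
Proof.
move=> [g0 ug0 Fg0]; split; [by exists g0|by move=> g []|].
move=> g h [ug Fg] [uh Fh]; exists (fun x => g x `&` h x); split.
- split; first by apply: uscoI => //; exact: mfilter_meet.
  apply: filterS (filterI Fg Fh) => f [fg fh] x z fz.
  by split; [exact: fg|exact: fh].
- by move=> x z [].
- by move=> x z [].
Qed.

Lemma mconvergesP (f : musco X Z) : mconverges F f <->
  mbounded F /\ forall W O x, open W -> open O -> W x ->
    musco_fun f x `&` O !=set0 ->
    exists g, [/\ usco g, F (musco_below g) & exists2 y, W y & g y `<=` O].
Proof.
split=> [[bF Ff]|[bF loc]]; split => //.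
  move=> W O x oW oO Wx [z [fz Oz]]; apply: contrapT => nO.
  have dF := mfilter_directed bF.
  set G := [set g | _] in dF.
  (* Every [g] in [G] meets the complement of [O] at each point of [W], so the intersection does
     too. A minimal map [k] below the intersection cut to that complement over [W] lies in every
     [[g]], hence is [f], which contradicts [z]. *)
  have GO y : W y -> (\bigcap_(g in G) g y) `&` ~` O !=set0.
    move=> Wy; apply: directed_usco_meet => //; first exact: open_closedC.
    move=> g [ug Fg]; apply: contrapT => gO; apply: nO.
    exists g; split => //; exists y => // w gw.
    by apply: contrapT => nOw; apply: gO; exists w.
  have [k kr] := musco_below_nonempty
    (usco_restr (usco_bigcap hZ dF) oW (open_closedC oO) GO).
  have kf : k = f.
    suff : [set f] k by [].
    by rewrite Ff => g Gg y w /kr[/(_ g Gg)].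
  by move: fz; rewrite -kf => /kr[_ /(_ Wx)].
(* A usco map [h] that meets every such [g] everywhere contains [f]. Otherwise a point [z] of [f x]
   and the compact [h x] have disjoint neighbourhoods [U] and [V], and [loc] finds a [g] with a
   value inside [U] at a point where [h] is inside [V]. *)
have fsub (h : X -> set Z) : usco h ->
    (forall g, usco g -> F (musco_below g) -> forall x, g x `&` h x !=set0) ->
    subgraph (musco_fun f) h.
  move=> [h1 h2] gh x z fz; apply: contrapT => nhz.
  have [|U [V [oU oV zU hV UV]]] := compact_setX_sub_open (compact_set1 (x := z))
    (h1 x).2 (closed_openC (closed_diagonal hZ)).
    by move=> [a b] [/= -> hb] ab; apply: nhz; rewrite ab.
  have [||g [ug Fg [y hyV gyU]]] := loc _ _ x (h2 V oV) oU.
  - exact: hV.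
  - by exists z; split => //; exact: zU.
  have [w [gw hw]] := gh g ug Fg y.
  by have /= := UV (w, w); apply => //; split; [exact: gyU|exact: hyV].
apply/seteqP; split=> [_ -> g [ug Fg]|k kF].
  by apply: fsub => // h uh Fh x; exact: mfilter_meet.
(* Any [k] in all the sets [[g]] meets each [g], so it contains [f], and its minimality gives
   equality. *)
apply: musco_fun_inj; apply/esym.
have [_] := musco_minimal k; apply; first exact: musco_usco.
apply: fsub; first exact: musco_usco.
move=> g ug Fg x; have [z kz] := musco_nonempty k x.
by exists z; split => //; exact: (kF g (conj ug Fg)).
Qed.

End filter.
End mconvergence.

(** * Minimal usco maps into a metric space *)

Section metric.
Context {R : realType} {X : topologicalType} {Y : metricType R}.
Local Notation M := (musco X Y).
Local Notation MM := (musco X (Y * Y)%type).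

Lemma mdist_continuous : continuous (fun p : Y * Y => mdist p.1 p.2 : R).
Proof.
move=> [a b]; apply/cvgrPdist_lt => e e0.
have e2 : 0 < e / 2 by rewrite divr_gt0.
exists (ball a (e / 2), ball b (e / 2)).
  by split; exact: nbhsx_ballx.
move=> [a' b'] [/=]; rewrite !ballEmdist /= => aa' bb'.
have := metric_triangle a a' b; have := metric_triangle a' b' b.
have := metric_triangle a' a b'; have := metric_triangle a b b'.
rewrite (metric_sym b' b) (metric_sym a' a) => *.
by rewrite ltr_norml; apply/andP; split; lra.
Qed.

Lemma closed_mdist_le (e : R) : closed [set p : Y * Y | mdist p.1 p.2 <= e].
Proof. by apply: (closed_comp _ (@closed_le R e)) => p _; exact: mdist_continuous. Qed.

Lemma open_mdist_lt (e : R) : open [set p : Y * Y | mdist p.1 p.2 < e].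
Proof. by apply: (open_comp _ (@open_lt R e)) => p _; exact: mdist_continuous. Qed.

Lemma usco_rho_comp (phi : X -> set (Y * Y)) : usco phi -> usco (rho_comp phi).
Proof. by apply: usco_image; exact: mdist_continuous. Qed.

(** A bound on the oscillation of [f] near [x]. These sets are open, dense when [f] is minimal, and
    [f] is single-valued on their intersection over [n]. *)
Definition small_at (f : X -> set Y) (n : nat) : set X :=
  [set x | exists V y,
    [/\ open V, V x & forall v, V v -> f v `<=` ball y n.+1%:R^-1]].

Lemma open_small_at f n : open (small_at f n).
Proof.
apply: open_local => x [V [y [oV Vx Vf]]]; exists V; split => // v Vv.
by exists V, y.
Qed.

Lemma dense_small_at f n : minimal_usco f -> dense (small_at f n).
Proof.
move=> mf W [x Wx] oW.
have [[/(_ x)[[y fy] _] _] _] := mf.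
have n0 : 0 < n.+1%:R^-1 :> R by rewrite invr_gt0.
have [||V [oV [v Vv] VW Vf]] :=
  minimal_usco_local (O := (ball y n.+1%:R^-1)°) mf oW _ Wx.
- exact: open_interior.
- by exists y; split => //; apply: nbhs_singleton; apply: nbhs_interior; exact: nbhsx_ballx.
exists v; split; first exact: VW.
by exists V, y; split => // w /Vf; move=> h z /h /interior_subset.
Qed.

Lemma small_at_subset1 f x : (forall n, small_at f n x) -> is_subset1 (f x).
Proof.
move=> fx y z fy fz; apply/mdist_positivity/eqP; rewrite eq_le mdist_ge0 andbT.
apply/ler_addgt0Pl => e e0; rewrite addr0.
have [n ne] : exists n, n.+1%:R^-1 < e / 2 :> R.
  have e2 : 0 < e / 2 by rewrite divr_gt0.
  have [n _ /(_ n (leqnn n))] := near_infty_natSinv_lt (PosNum e2).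
  by exists n.
have [V [w [_ Vx Vf]]] := fx n.
have := Vf x Vx y fy; have := Vf x Vx z fz; rewrite !ballEmdist /= => wz wy.
have := metric_triangle y w z; rewrite (metric_sym y w).
move: ne wy wz; move: (n.+1%:R^-1) (mdist w y) (mdist w z) (mdist y z) => a b c d.
by lra.
Qed.

(** The Baire property applied to the open dense sets where both maps oscillate little. *)
Lemma dense_subset1 (hX : baire_space X) (f g : X -> set Y) :
  minimal_usco f -> minimal_usco g ->
  dense [set x | is_subset1 (f x) /\ is_subset1 (g x)].
Proof.
move=> mf mg W W0 oW.
have [n|x [Wx fgx]] := hX (fun n => small_at f n `&` small_at g n) _ W W0 oW.
  split; first by apply: openI; exact: open_small_at.
  by apply: denseI; [exact: open_small_at|exact: dense_small_at|exact: dense_small_at].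
exists x; split => //; split; apply: small_at_subset1 => n; by have [] := fgx n I.
Qed.

(** Two minimal maps below the product agree wherever both factors are single-valued. They therefore
    meet on a dense set, hence everywhere, hence are equal. *)
Lemma is_chi_exists (hX : baire_space X) (p : M * M) : exists h : MM, is_chi p h.
Proof.
have hY := hausdorff_setX (@metric_hausdorff R Y) (@metric_hausdorff R Y).
have u := usco_setX (musco_usco p.1) (musco_usco p.2).
have [h hp] := musco_below_nonempty hY u.
exists h; apply/seteqP; split=> [_ -> //|k kp].
apply: musco_fun_inj; apply: minimal_usco_eq => //; try exact: musco_minimal.
apply: (usco_meet_dense hY (musco_usco k) (musco_usco h)
  (dense_subset1 hX (musco_minimal p.1) (musco_minimal p.2))).
move=> x [s1 s2].
have [[a b] kab] := musco_nonempty k x; have [[a' b'] hab] := musco_nonempty h x.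
have [/= pa pb] := kp _ _ kab; have [/= pa' pb'] := hp _ _ hab.
by exists (a, b); split => //; rewrite (s1 _ _ pa pa') (s2 _ _ pb pb').
Qed.

(** Every usco map below the product contains a minimal one, which by uniqueness is [h]; so [h] is
    the least usco map below the product. *)
Lemma is_chiP (p : M * M) (h : MM) : is_chi p h ->
  subgraph (musco_fun h) (usco_prod (musco_fun p.1) (musco_fun p.2)) /\
  forall g, usco g -> subgraph g (usco_prod (musco_fun p.1) (musco_fun p.2)) ->
    subgraph (musco_fun h) g.
Proof.
move=> chip; split.
  by change (musco_below (usco_prod (musco_fun p.1) (musco_fun p.2)) h); rewrite -chip.
move=> g ug gp.
have hY := hausdorff_setX (@metric_hausdorff R Y) (@metric_hausdorff R Y).
have [k kg] := musco_below_nonempty hY ug.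
suff <- : k = h by [].
suff : [set h] k by [].
by rewrite chip; exact: musco_below_sub kg.
Qed.

End metric.

(** * A local description of Upsilon *)

Section upsilon.
Context {R : realType} {X : topologicalType} {Y : metricType R}.
Context (hX : baire_space X).
Local Notation M := (musco X Y).
Local Notation MM := (musco X (Y * Y)%type).

Let hYY : hausdorff_space (Y * Y)%type.
Proof. by apply: hausdorff_setX; exact: metric_hausdorff. Qed.

(** The images form a base; they are nonempty because chi is defined on every pair. *)
Lemma chi_filterE (U : set_system (M * M)) : ProperFilter U ->
  chi_filter U = filter_from (@chi_image R X Y @` U) id /\ ProperFilter (chi_filter U).
Proof.
move=> FU.
have G0 : @chi_image R X Y @` U !=set0.
  by exists (chi_image setT); exists setT => //; exact: filterT.
have GI A B : (@chi_image R X Y @` U) A -> (@chi_image R X Y @` U) B ->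
    exists2 C, (@chi_image R X Y @` U) C & C `<=` A `&` B.
  move=> [A' UA' <-] [B' UB' <-]; exists (chi_image (A' `&` B')).
    by exists (A' `&` B') => //; exact: filterI.
  by move=> h [p [Ap Bp] ph]; split; exists p.
split; first exact: filter_generatedE.
apply: filter_generated_proper => // _ [A UA <-].
have [p Ap] := filter_ex UA; have [h ph] := is_chi_exists hX p.
by exists h, p.
Qed.

Lemma chi_filterP (U : set_system (M * M)) (S : set MM) : ProperFilter U ->
  chi_filter U S <-> exists2 A, U A & forall p h, A p -> is_chi p h -> S h.
Proof.
move=> /chi_filterE[-> _]; split=> [[_ [A UA <-] AS]|[A UA AS]].
  by exists A => // p h Ap ph; apply: AS; exists p.
by exists (chi_image A); [exists A|move=> h [p Ap]; exact: AS].
Qed.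

(** The generators form a base because the usco maps [phi] with [[phi]] in the bounded filter
    [chi_filter U] are directed. *)
Lemma rho_filterE (U : set_system (M * M)) : ProperFilter U ->
  mbounded (chi_filter U) ->
  rho_filter U = filter_from [set musco_below (rho_comp phi) |
      phi in [set phi | usco phi /\ chi_filter U (musco_below phi)]] id /\
  ProperFilter (rho_filter U).
Proof.
move=> FU bU; have [_ Fchi] := chi_filterE FU.
have [[phi0 Gphi0] Gusco Gdir] := mfilter_directed hYY bU.
set G := [set musco_below _ | _ in _].
have G0 : G !=set0 by exists (musco_below (rho_comp phi0)), phi0.
have GI A B : G A -> G B -> exists2 C, G C & C `<=` A `&` B.
  move=> [a Ga <-] [b Gb <-]; have [c [Gc ca cb]] := Gdir a b Ga Gb.
  exists (musco_below (rho_comp c)); first by exists c.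
  move=> h hc; split; apply: musco_below_sub hc.
    by move=> x; apply: image_subset; exact: ca.
  by move=> x; apply: image_subset; exact: cb.
split; first exact: filter_generatedE.
apply: filter_generated_proper => // _ [phi [uphi _] <-].
by apply: musco_below_nonempty; [exact: Rhausdorff|exact: usco_rho_comp].
Qed.

(** One close pair of values per point is enough: the condition on distances is closed, so over an
    open [V] the least usco map below the product has all its values in it. *)
Definition close_on (V : set X) (e : R) (p : M * M) : Prop :=
  forall x, V x ->
    exists y z, [/\ musco_fun p.1 x y, musco_fun p.2 x z & mdist y z <= e].

(** The same [psi] bounds both coordinates, which makes the condition stable under swapping them. *)
Record uniformly_small (U : set_system (M * M)) : Prop := {
  us_filter : ProperFilter U;
  us_bounded : exists2 psi, usco psi &
    U [set p | musco_below psi p.1 /\ musco_below psi p.2];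
  us_close : forall (W : set X) (e : R), W !=set0 -> open W -> 0 < e ->
    exists V, [/\ open V, V !=set0, V `<=` W & U (close_on V e)]
}.

Lemma mconverges_cstP (F : set_system (musco X R)) : ProperFilter F ->
  mconverges_cst F 0 <->
  mbounded F /\ forall W (e : R), W !=set0 -> open W -> 0 < e ->
    exists g, [/\ usco g, F (musco_below g) &
      exists2 x, W x & g x `<=` [set r | `|r| < e]].
Proof.
move=> FF.
have min0 : @minimal_usco X R (fun=> [set 0]).
  split; first exact: usco_cst1.
  move=> h [h1 _] h0; apply/funext => x; apply/seteqP; split; first exact: h0.
  by move=> _ ->; have [[r hr] _] := h1 x; have := h0 _ _ hr => /= <-.
pose f0 : musco X R := exist _ _ min0.
split=> [[f f0E /(mconvergesP (@Rhausdorff R))[bF loc]]|[bF loc]].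
  split=> // W e [x Wx] oW e0.
  apply: (loc W [set r | `|r| < e] x) => //.
    rewrite (_ : mkset _ = ball (0 : R) e); first exact: ball_open.
    by apply/seteqP; split => r; rewrite /ball /= sub0r normrN.
  by rewrite f0E; exists 0; split => //=; rewrite normr0.
exists f0 => //; apply/(mconvergesP (@Rhausdorff R)); split => //.
move=> W O x oW oO Wx [_ [-> O0]].
have [e e0 eO] : exists2 e : R, 0 < e & [set r | `|r| < e] `<=` O.
  have /nbhs_ballP[e e0 eO] := open_nbhs_nbhs (conj oO O0).
  by exists e => // r re; apply: eO; rewrite /ball /= sub0r normrN.
have [|g [ug Fg [y Wy gy]]] := loc W e _ oW e0; first by exists x.
by exists g; split => //; exists y => // r /gy /eO.
Qed.

Lemma Upsilon_uniformly_small (U : set_system (M * M)) :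
  Upsilon X Y U -> uniformly_small U.
Proof.
move=> [FU bU cU]; have [rhoE Frho] := rho_filterE FU bU.
have [_ Fchi] := chi_filterE FU.
split => //.
  have [phi uphi /(chi_filterP _ FU)[A UA Aphi]] := bU.
  have u1 : usco (fun x => fst @` phi x) by apply: usco_image => // q; exact: cvg_fst.
  have u2 : usco (fun x => snd @` phi x) by apply: usco_image => // q; exact: cvg_snd.
  (* Since chi of [p] lies below both [phi] and the product, each coordinate of [p] meets the
     matching projection of [phi] everywhere, and minimality puts it inside. *)
  exists (fun x => fst @` phi x `|` snd @` phi x); first exact: uscoU.
  apply: filterS UA => p Ap; have [h ph] := is_chi_exists hX p.
  have hphi := Aphi p h Ap ph; have [hp _] := is_chiP ph.
  split.
    apply: (@musco_below_sub _ _ (fun x => fst @` phi x)); first by move=> x z; left.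
    apply: minimal_usco_sub u1 _; [exact: metric_hausdorff|exact: musco_minimal|].
    move=> x; have [q hq] := musco_nonempty h x.
    by exists q.1; split; [have [] := hp _ _ hq|exists q => //; exact: hphi].
  apply: (@musco_below_sub _ _ (fun x => snd @` phi x)); first by move=> x z; right.
  apply: minimal_usco_sub u2 _; [exact: metric_hausdorff|exact: musco_minimal|].
  move=> x; have [q hq] := musco_nonempty h x.
  by exists q.2; split; [have [] := hp _ _ hq|exists q => //; exact: hphi].
move=> W e W0 oW e0.
have [_ loc] := (mconverges_cstP Frho).1 cU.
have [g [ug gF [x0 Wx0 gx0]]] := loc W e W0 oW e0.
move: gF; rewrite rhoE => -[_ [phi [uphi chiphi] <-] phig].
pose V := W `&` [set x | g x `<=` ball (0 : R) e].
have ballE : ball (0 : R) e = [set r | `|r| < e].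
  by apply/seteqP; split => r; rewrite /ball /= sub0r normrN.
have oV : open V by apply: openI => //; case: ug => _; apply; exact: ball_open.
(* The inclusion [phig] compares only the minimal maps below [rho_comp phi] and [g], not these maps
   themselves. If [rho_comp phi] left the ball at every point of [V], a minimal map below it would
   stay outside the ball over [V] and yet lie below [g], which is impossible at [x0]. *)
have [x [Vx phix]] : exists x, V x /\ rho_comp phi x `<=` ball (0 : R) e.
  apply: contrapT => nV.
  have urho := usco_rho_comp uphi.
  have [|k kr] := musco_below_nonempty (@Rhausdorff R)
      (usco_restr (C := ~` ball (0 : R) e) urho oV (open_closedC (ball_open _ _)) _).
    move=> x Vx; apply: contrapT => nr; apply: nV; exists x; split => // r phir.
    by apply: contrapT => rb; apply: nr; exists r.
  have kg : musco_below g k.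
    by apply: phig; apply: musco_below_sub kr => x z [].
  have Vx0 : V x0 by split => //; rewrite /= ballE.
  have [r kr0] := musco_nonempty k x0.
  have [_ /(_ Vx0)] := kr _ _ kr0; apply.
  by case: Vx0 => _; apply; exact: kg.
exists (W `&` [set x | phi x `<=` [set q | mdist q.1 q.2 < e]]).
split.
- by apply: openI => //; case: uphi => _; apply; exact: open_mdist_lt.
- exists x; split; first by case: Vx.
  move=> q phiq; have : rho_comp phi x (mdist q.1 q.2) by exists q.
  by move=> /phix; rewrite ballE /= ger0_norm // mdist_ge0.
- by move=> y [].
have [A UA Aphi] := (chi_filterP _ FU).1 chiphi.
apply: filterS UA => p Ap y [Wy phiy].
have [h ph] := is_chi_exists hX p; have [hp _] := is_chiP ph.
have [q hq] := musco_nonempty h y; exists q.1, q.2.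
have [? ?] := hp _ _ hq; split => //; apply: ltW; apply: phiy.
exact: (Aphi p h Ap ph).
Qed.

Lemma uniformly_small_Upsilon (U : set_system (M * M)) :
  uniformly_small U -> Upsilon X Y U.
Proof.
move=> [FU [psi upsi Upsi] Uclose].
have upp : usco (usco_prod psi psi) by exact: usco_setX.
have chi_psi p h : musco_below psi p.1 /\ musco_below psi p.2 -> is_chi p h ->
    musco_below (usco_prod psi psi) h.
  move=> [p1 p2] /is_chiP[hp _] x q /hp[/= q1 q2].
  by split; [exact: p1|exact: p2].
have chipp : chi_filter U (musco_below (usco_prod psi psi)).
  by apply/chi_filterP; eexists; [exact: Upsi|exact: chi_psi].
have bU : mbounded (chi_filter U) by exists (usco_prod psi psi).
split => //.
have [rhoE Frho] := rho_filterE FU bU.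
apply/mconverges_cstP; split.
  exists (rho_comp (usco_prod psi psi)); first exact: usco_rho_comp.
  rewrite rhoE; exists (musco_below (rho_comp (usco_prod psi psi))) => //.
  by exists (usco_prod psi psi).
move=> W e W0 oW e0.
(* Halving turns the closed bound, needed to cut [usco_prod psi psi], into the strict bound [e] of
   the goal. *)
have e2 : 0 < e / 2 by rewrite divr_gt0.
have [V [oV [x Vx] VW UV]] := Uclose W (e / 2) W0 oW e2.
pose C := [set q : Y * Y | mdist q.1 q.2 <= e / 2].
have cC : closed C by exact: closed_mdist_le.
have uphi : usco (restr (usco_prod psi psi) V C).
  apply: usco_restr => // y Vy; have [p [pV [p1 p2]]] := filter_ex (filterI UV Upsi).
  have [a [b [pa pb ab]]] := pV y Vy.
  by exists (a, b); split => //; split; [exact: p1|exact: p2].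
exists (rho_comp (restr (usco_prod psi psi) V C)); split.
- exact: usco_rho_comp.
- rewrite rhoE; exists (musco_below (rho_comp (restr (usco_prod psi psi) V C))) => //.
  exists (restr (usco_prod psi psi) V C) => //; split => //.
  apply/chi_filterP; exists (close_on V (e / 2) `&`
      [set p | musco_below psi p.1 /\ musco_below psi p.2]).
    exact: filterI.
  move=> p h [pV ppsi] ph y q hq; split; first exact: chi_psi ph _ _ hq.
  move=> Vy; have [_ hmin] := is_chiP ph.
  (* As the least usco map below the product of [p], [h] lies in that product cut to [C] over
     [V]. *)
  have [||_] := hmin (restr (usco_prod (musco_fun p.1) (musco_fun p.2)) V C) _ _ _ _ hq.
  + apply: usco_restr => //; first by apply: usco_setX; exact: musco_usco.
    by move=> w Vw; have [a [b [pa pb ab]]] := pV w Vw; exists (a, b).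
  + by move=> w z [].
  exact.
exists x; first exact: VW.
move=> _ [q [_ /(_ Vx) qC] <-] /=; rewrite ger0_norm ?mdist_ge0 //.
by apply: le_lt_trans qC _; rewrite ltr_pdivrMr // ltr_pMr // ltr1n.
Qed.

End upsilon.

(** * The axioms and the induced convergence, in local form *)

Section uniform_structure.
Context {R : realType} {X : topologicalType} {Y : metricType R}.
Context (hX : baire_space X).
Local Notation M := (musco X Y).

(** If all values of [f] and [g] at [x] were more than [e + d] apart, the same would hold on an open
    set around [x]. That set contains a point where [h] is single-valued; there the two intermediate
    values coincide and the triangle inequality applies. *)
Lemma close_on_comp (V : set X) (e d : R) (f g h : M) : open V ->
  close_on V e (f, h) -> close_on V d (h, g) -> close_on V (e + d) (f, g).
Proof.
move=> oV fh hg x Vx; apply: contrapT => nfg.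
have [_ ufg] := usco_setX (musco_usco f) (musco_usco g).
have oN := openI oV (ufg _ (closed_openC (@closed_mdist_le R Y (e + d)))).
have [|y [[Vy fgy] [hy _]]] :=
  dense_subset1 hX (musco_minimal h) (musco_minimal h) _ oN.
  exists x; split => // -[a b] [/= fa gb] ab.
  by apply: nfg; exists a, b.
have [a [b [/= fa hb ab]]] := fh y Vy; have [b' [c [/= hb' gc bc]]] := hg y Vy.
apply: (fgy (a, c)); first by [].
rewrite /= (le_trans (metric_triangle a b c)) // lerD //.
by rewrite (hy b b').
Qed.

Lemma us_diagonal (f : M) :
  uniformly_small (filter_prod (principal_filter f) (principal_filter f)).
Proof.
have FU : ProperFilter (filter_prod (principal_filter f) (principal_filter f)).
  by have Ff := principal_filter_proper f; exact: filter_prod_proper.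
have fU (S : set (M * M)) : S (f, f) ->
    filter_prod (principal_filter f) (principal_filter f) S.
  move=> Sf; exists ([set f], [set f]); first by split.
  by move=> [a b] [/= -> ->].
split => //.
  by exists (musco_fun f); [exact: musco_usco|apply: fU; split => x z].
move=> W e W0 oW e0; exists W; split => //; apply: fU => x Wx.
have [y fy] := musco_nonempty f x.
by exists y, y; split => //; rewrite mdistxx ltW.
Qed.

Lemma us_setI (U V : set_system (M * M)) :
  uniformly_small U -> uniformly_small V -> uniformly_small (U `&` V).
Proof.
move=> [FU [psi upsi Upsi] Uc] [FV [phi uphi Vphi] Vc].
split.
- split; first by move=> [/filter_ex[]].
  split; first by split; exact: filterT.
    by move=> A B [UA VA] [UB VB]; split; exact: filterI.
  by move=> A B AB [UA VA]; split; exact: filterS AB _.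
- exists (fun x => psi x `|` phi x); first exact: uscoU.
  split; [apply: filterS Upsi|apply: filterS Vphi] => p [p1 p2].
    by split; [apply: musco_below_sub p1|apply: musco_below_sub p2] => x z; left.
  by split; [apply: musco_below_sub p1|apply: musco_below_sub p2] => x z; right.
move=> W e W0 oW e0.
have [W' [oW' W'0 W'W UW']] := Uc W e W0 oW e0.
(* Shrinking inside [W'] instead of [W] yields one open set that serves both filters. *)
have [W'' [oW'' W''0 W''W' VW'']] := Vc W' e W'0 oW' e0.
exists W''; split => //; first exact: subset_trans W'W.
by split=> //; apply: filterS UW' => p pW' x /W''W'; exact: pW'.
Qed.

Lemma us_sub (U V : set_system (M * M)) :
  uniformly_small U -> ProperFilter V -> U `<=` V -> uniformly_small V.
Proof.
move=> [FU [psi upsi Upsi] Uc] FV UV; split => //.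
  by exists psi => //; exact: UV.
move=> W e W0 oW e0; have [W' [oW' W'0 W'W UW']] := Uc W e W0 oW e0.
by exists W'; split => //; exact: UV.
Qed.

Lemma us_inverse (U : set_system (M * M)) :
  uniformly_small U -> uniformly_small (inverse_filter U).
Proof.
move=> [FU [psi upsi Upsi] Uc].
(* Inversion is an involution, so the direct image is also an inverse image, for which the filter
   laws are immediate. *)
have invE : inverse_filter U = [set A | U (A^-1)%relation].
  apply/seteqP; split=> [_ [A UA <-]|A UA] //.
    by rewrite /= (_ : (A^-1^-1)%relation = A) //; apply/seteqP; split => -[].
  by exists (A^-1)%relation => //; apply/seteqP; split => -[].
rewrite invE; split.
- split; first by move=> /filter_ex[].
  split; first exact: filterT.
    by move=> A B /= UA UB; apply: filterS (filterI UA UB) => -[].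
  by move=> A B AB /= UA; apply: filterS UA => -[a b] /AB.
- by exists psi => //=; apply: filterS Upsi => -[a b] [].
move=> W e W0 oW e0; have [W' [oW' W'0 W'W UW']] := Uc W e W0 oW e0.
exists W'; split => //=; apply: filterS UW' => -[a b] pV x /pV[y [z [ay bz yz]]].
by exists z, y; split => //; rewrite metric_sym.
Qed.

Lemma us_comp (U V : set_system (M * M)) : uniformly_small U ->
  uniformly_small V -> comp_exists U V -> uniformly_small (comp_filter U V).
Proof.
move=> [FU [psi upsi Upsi] Uc] [FV [phi uphi Vphi] Vc] UV.
have FC : ProperFilter (comp_filter U V).
  apply: filter_generated_proper.
  - exists ([set: M * M] \; [set: M * M])%relation; exists setT, setT.
    by split => //; exact: filterT.
  - move=> _ _ [A [B [UA VB ->]]] [A' [B' [UA' VB' ->]]].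
    exists ((B `&` B') \; (A `&` A'))%relation.
      by exists (A `&` A'), (B `&` B'); split => //; exact: filterI.
    by move=> [a c] [b [Bab B'ab] [Abc A'bc]]; split; exists b.
  - by move=> _ [A [B [UA VB ->]]]; exact: UV.
have gen A B (S : set (M * M)) : U A -> V B ->
    (forall f h g, A (f, h) -> B (h, g) -> S (f, g)) -> comp_filter U V S.
  move=> UA VB ABS.
  have BAS : (B \; A)%relation `<=` S by move=> [f g] [h]; exact: ABS.
  by apply: filterS BAS _; apply: sub_gen_smallest; exists A, B.
split => //.
  exists (fun x => psi x `|` phi x); first exact: uscoU.
  apply: gen Upsi Vphi _ => f h g [/= ff _] [_ gg].
  by split=> x z pz; [left; exact: ff|right; exact: gg].
move=> W e W0 oW e0; have e2 : 0 < e / 2 by rewrite divr_gt0.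
have [W' [oW' W'0 W'W UW']] := Uc W _ W0 oW e2.
have [W'' [oW'' W''0 W''W' VW'']] := Vc W' _ W'0 oW' e2.
exists W''; split => //; first exact: subset_trans W'W.
apply: gen UW' VW'' _ => f h g fh hg; rewrite (splitr e).
by apply: close_on_comp hg => // x /W''W'; exact: fh.
Qed.

(** Both directions first pass to an open set over which [f] stays near one point [y]; closeness to
    [f] and closeness to [y] are then interchangeable. *)
Lemma us_principal_prod (f : M) (F : set_system M) : ProperFilter F ->
  uniformly_small (filter_prod (principal_filter f) F) <-> mconverges F f.
Proof.
move=> FF; have hY := @metric_hausdorff R Y.
have FU : ProperFilter (filter_prod (principal_filter f) F).
  by have Ff := principal_filter_proper f; exact: filter_prod_proper.
have FfS (S : set (M * M)) :
    filter_prod (principal_filter f) F S <-> F [set g | S (f, g)].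
  split=> [[[A B] /= [Af FB] AB]|FS].
    by apply: filterS FB => g Bg; apply: AB; split => //; exact: Af.
  exists ([set f], [set g | S (f, g)]); first by split.
  by move=> [a b] [/= ->].
split=> [[_ [psi upsi /FfS Fpsi] Fc]|cF].
  have {}Fpsi : F (musco_below psi) by apply: filterS Fpsi => g [].
  apply/(mconvergesP hY); split; first by exists psi.
  move=> W O x oW oO Wx [y [fy Oy]].
  have /nbhs_ballP[e /= e0 eO] := open_nbhs_nbhs (conj oO Oy).
  have e2 : 0 < e / 2 by rewrite divr_gt0.
  have e4 : 0 < e / 4 by rewrite divr_gt0.
  have [||V [oV V0 VW fV]] :=
    minimal_usco_local (O := (ball y (e / 4))°) (musco_minimal f) oW _ Wx.
  - exact: open_interior.
  - by exists y; split => //; apply: nbhs_singleton; apply: nbhs_interior; exact: nbhsx_ballx.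
  have [V' [oV' [x' V'x'] V'V /FfS FV']] := Fc V _ V0 oV e4.
  (* Over [V'], [f] is within [e / 4] of [y] and some value of [g] within [e / 4] of [f], so [g]
     meets [C]; minimality puts [g] inside [C]. Hence [psi] cut to [C] over [V'] still bounds a
     member of [F]. *)
  pose C := [set z | mdist y z <= e / 2].
  have cC : closed C.
    apply: (closed_comp (f := pair y) _ (@closed_mdist_le R Y (e / 2))) => z _.
    by apply: cvg_pair => //; exact: cvg_cst.
  have gC g : close_on V' (e / 4) (f, g) ->
      forall v, V' v -> musco_fun g v `&` C !=set0.
    move=> fg v V'v; have [a [b [/= fa gb ab]]] := fg v V'v; exists b; split => //.
    have /interior_subset := fV v (V'V _ V'v) _ fa; rewrite ballEmdist /= => ya.
    rewrite /C /=; have := metric_triangle y a b; lra.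
  exists (restr psi V' C); split.
  - apply: usco_restr => // v V'v; have [g [fg gpsi]] := filter_ex (filterI FV' Fpsi).
    by have [z [gz Cz]] := gC g fg v V'v; exists z; split => //; exact: gpsi.
  - apply: filterS (filterI FV' Fpsi) => g [fg gpsi] v z gz; split; first exact: gpsi.
    move=> V'v.
    exact: (minimal_usco_sub_closed (musco_minimal g) oV' cC (gC g fg) V'v gz).
  exists x'; first by apply: VW; exact: V'V.
  move=> z [_ /(_ V'x') Cz]; apply: eO; rewrite ballEmdist /=.
  by apply: le_lt_trans Cz _; lra.
have [[psi upsi Fpsi] loc] := (mconvergesP hY f).1 cF.
split => //.
  exists (fun x => musco_fun f x `|` psi x); first exact: uscoU (musco_usco f) upsi.
  apply/FfS; apply: filterS Fpsi => g gpsi.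
  by split=> x z pz; [left|right; exact: gpsi].
move=> W e [x Wx] oW e0; have e2 : 0 < e / 2 by rewrite divr_gt0.
have [y fy] := musco_nonempty f x.
pose O := (ball y (e / 2))°.
have fO : musco_fun f x `&` O !=set0.
  by exists y; split => //; apply: nbhs_singleton; apply: nbhs_interior; exact: nbhsx_ballx.
have oO : open O by exact: open_interior.
have [V [oV [v Vv] VW fV]] := minimal_usco_local (musco_minimal f) oW oO Wx fO.
have fvO : musco_fun f v `&` O !=set0.
  by have [z fz] := musco_nonempty f v; exists z; split => //; exact: fV fz.
have [g [ug Fg [x' Vx' gx']]] := loc V O v oV oO Vv fvO.
(* On this set [f] and every [k] below [g] stay within [e / 2] of [y]. *)
exists (V `&` [set x | g x `<=` O]); split.
- by apply: openI => //; case: ug => _; exact.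
- by exists x'.
- by move=> w [/VW].
apply/FfS; apply: filterS Fg => k kg w [Vw gw].
have [a fa] := musco_nonempty f w; have [b kb] := musco_nonempty k w.
exists a, b; split => //.
have /interior_subset := fV w Vw _ fa; have /interior_subset := gw _ (kg _ _ kb).
rewrite !ballEmdist /= => yb ya; have := metric_triangle a y b.
rewrite (metric_sym a y); lra.
Qed.

End uniform_structure.

Theorem theorem33 (R : realType) (X : topologicalType) (Y : metricType R)
    (hX : baire_space X) :
  uniform_convergence_structure (Upsilon X Y) /\
  induces_convergence (Upsilon X Y) (@mconverges X Y).
Proof.
have UE U : Upsilon X Y U <-> uniformly_small U.
  by split; [exact: Upsilon_uniformly_small|exact: uniformly_small_Upsilon].
split; first split.
- by move=> U /UE[].
- by move=> f; apply/UE; exact: us_diagonal.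
- by move=> U V /UE uU /UE uV; apply/UE; exact: us_setI.
- by move=> U V /UE uU FV UV; apply/UE; exact: us_sub uU FV UV.
- by move=> U /UE uU; apply/UE; exact: us_inverse.
- by move=> U V /UE uU /UE uV UV; apply/UE; exact: us_comp.
by move=> f F FF; rewrite -(us_principal_prod f FF); exact: UE.
Qed.
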